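(* Let $R\subset\mathbb{N}$ be a set of strong recurrence. Then for any $A\subset\mathbb{N}$ with $\mathsf{d}^*(A)>0$ there exist infinite sets $B\subset R$ and $C\subset A$ such that $\{b+c: b\in B,\ c\in C,\ b<c\}\subset A$.
   Context: $\mathsf{d}^*(A)=\limsup_{N-M\to\infty}\frac{|A\cap\{M+1,\dots,N\}|}{N-M}$ is the upper Banach density. A measure preserving system $(X,\mathcal{B},\mu,T)$ is a probability space with a measurable measure-preserving map $T:X\to X$. A set $R\subset\mathbb{N}$ is a set of strong recurrence if for every measure preserving system $(X,\mathcal{B},\mu,T)$ and every $E\in\mathcal{B}$ with $\mu(E)>0$ one has $\limsup_{n\in R,\,n\to\infty}\mu(E\cap T^{-n}E)>0$. *)

(* Defs.v *)
From HB Require Import structures.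
From mathcomp Require Import all_boot all_order all_algebra finmap.
From mathcomp Require Import all_classical all_reals all_analysis.

Set Implicit Arguments.
Unset Strict Implicit.
Unset Printing Implicit Defensive.

Import Order.TTheory GRing.Theory Num.Theory.
Import numFieldNormedType.Exports.

Local Open Scope classical_set_scope.
Local Open Scope ring_scope.

(* The filter "N - M --> +oo" on pairs (M, N).  Subtraction is truncated, so
   a lower bound k.+1 <= N - M forces M < N. *)
Definition gap_to_infty : set_system (nat * nat) :=
  filter_from [set: nat] (fun k => [set p : nat * nat | (k <= p.2 - p.1)%N]).

Definition upper_banach_density (K : realType) (A : set nat) : \bar K :=
  limf_esup
    (fun p : nat * nat =>
       (#|` fset_set (A `&` [set n | (p.1 < n <= p.2)%N]) |%:R
          / (p.2 - p.1)%:R : K)%:E)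
    gap_to_infty.

Definition measure_preserving (K : realType) (d : measure_display)
    (X : measurableType d) (mu : probability X K) (T : X -> X) : Prop :=
  measurable_fun [set: X] T /\
  forall E : set X, measurable E -> mu (T @^-1` E) = mu E.

(* When S is finite the filter [within S \oo] contains the empty set and the
   limsup below is -oo: a finite set is not a set of strong recurrence. *)
Definition strong_recurrence (K : realType) (S : set nat) : Prop :=
  forall (d : measure_display) (X : measurableType d) (mu : probability X K)
         (T : X -> X),
    measure_preserving mu T ->
    forall E : set X, measurable E -> (0 < mu E)%E ->
      (0 < limf_esup (fun n => mu (E `&` iter n T @^-1` E)) (within S \oo))%E.

(* Main.v *)
(** Furstenberg correspondence: an ultrafilter on the windows that realize the
    upper Banach density of A yields a finitely additive shift-invariant mean m
    on sets of integers with m(A) > 0 and m = 0 on finite sets, and a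
    shift-invariant probability mu on {0,1}^nat with
    mu {y | y i = 1 for all i in s} = m (intersection of A - i for i in s).
    By strong recurrence mu (E `&` T^-n E) stays away from 0 along infinitely
    many n in R, where E = {y | y 0 = 1}.  Almost every point of the limsup of
    these sets avoids all null finite intersections of them; the set B0 of the
    indices n whose set contains such a point is infinite, and any finitely many
    of the sets with index in B0 meet in positive measure (Bergelson's
    intersectivity lemma).  Hence A and the A - b, for b in a finite subset of
    B0, have infinite intersection, and B and C are chosen alternately,
    b_0 < c_0 <= b_1 < c_1 <= .... *)
Require Import Defs.
From HB Require Import structures.
From mathcomp Require Import all_boot all_order all_algebra finmap.
From mathcomp Require Import all_classical all_reals all_analysis.
From mathcomp Require Import lra.

Set Implicit Arguments.
Unset Strict Implicit.
Unset Printing Implicit Defensive.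
Import Order.TTheory GRing.Theory Num.Theory.
Import numFieldNormedType.Exports.

Local Open Scope classical_set_scope.
Local Open Scope ring_scope.

(** * An invariant mean from the upper Banach density *)

Section window_density.
Context (K : realType).
Implicit Types (P Q : set nat) (p : nat * nat).

(** A sum of indicators makes additivity and telescoping immediate. The index is [i.+1] because the
    window excludes [p.1] and includes [p.2]; an empty window has density 0, as [0^-1 = 0]. *)
Definition window_density P p : K :=
  (\sum_(p.1 <= i < p.2) \1_P i.+1) / (p.2 - p.1)%:R.

Lemma window_densityE P p :
  (#|` fset_set (P `&` [set n | (p.1 < n <= p.2)%N]) |%:R
    / (p.2 - p.1)%:R : K) = window_density P p.
Proof.
congr (_ / _).
transitivity (\sum_(p.1.+1 <= i < p.2.+1) \1_P i : K); last by rewrite big_add1.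
pose s := [seq i <- index_iota p.1.+1 p.2.+1 | i \in P].
have Ps : P `&` [set n | (p.1 < n <= p.2)%N] = [set` s].
  apply/seteqP; split => i /=; rewrite mem_filter mem_index_iota ltnS.
    by move=> [/mem_set -> ->].
  by move=> /andP[/set_mem].
have fs : finite_set (P `&` [set n | (p.1 < n <= p.2)%N]).
  by rewrite Ps; exact: finite_seq.
rewrite (_ : #|` _| = size s).
  rewrite /s size_filter -sum1_count natr_sum big_mkcond /=.
  by apply: eq_bigr => i _; rewrite indicE; case: (_ \in _).
apply/perm_size/uniq_perm; first exact: fset_uniq.
  by rewrite filter_uniq// iota_uniq.
by move=> i; rewrite in_fset_set// Ps; apply/idP/idP => [/set_mem|/mem_set].
Qed.

Lemma window_density_ge0 P p : 0 <= window_density P p.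
Proof. by rewrite divr_ge0 ?ler0n// sumr_ge0. Qed.

Lemma window_density_le1 P p : window_density P p <= 1.
Proof.
rewrite /window_density.
have h : \sum_(p.1 <= i < p.2) \1_P i.+1 <= (p.2 - p.1)%:R :> K.
  rewrite -[(p.2 - p.1)%:R]mulr1 mulr_natl -sumr_const_nat.
  by apply: ler_sum => i _; rewrite indicE; case: (_ \in _).
have [->|k0] := eqVneq (p.2 - p.1)%N 0%N; first by rewrite invr0 mulr0.
by rewrite ler_pdivrMr ?mul1r// ltr0n lt0n.
Qed.

Lemma window_densityT p : (1 <= p.2 - p.1)%N -> window_density setT p = 1.
Proof.
move=> k0; rewrite /window_density.
under eq_bigr do rewrite indicT.
by rewrite sumr_const_nat divff// pnatr_eq0 -lt0n.
Qed.

Lemma window_densityU P Q p : P `&` Q = set0 ->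
  window_density (P `|` Q) p = window_density P p + window_density Q p.
Proof.
move=> PQ; rewrite /window_density -mulrDl -big_split; congr (_ / _).
apply: eq_bigr => i _; rewrite /= !indicE in_setU.
have := congr1 (fun S => i.+1 \in S) PQ; rewrite in_setI in_set0.
by case: (_ \in P); case: (_ \in Q); rewrite //= ?addr0 ?add0r.
Qed.

(** The difference telescopes to the two boundary indicators, which differ by at most 1. *)
Lemma window_density_shift P p :
  `|window_density [set k | P k.+1] p - window_density P p|
    <= (p.2 - p.1)%:R^-1.
Proof.
rewrite /window_density -mulrBl -sumrB normrM normfV normr_nat.
have -> : \sum_(p.1 <= i < p.2) (\1_[set k | P k.+1] i.+1 - \1_P i.+1) =
          \sum_(p.1 <= i < p.2) (\1_P i.+2 - \1_P i.+1) :> K.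
  by apply: eq_bigr => i _; congr (_%:R - _).
have [pp|pp] := leqP p.2 p.1.
  by move: pp; rewrite -subn_eq0 => /eqP ->; rewrite invr0 mulr0.
rewrite (telescope_sumr (fun i => \1_P i.+1)) 1?ltnW//.
rewrite ler_piMl// ?invr_ge0//.
rewrite !indicE; case: (_ \in _); case: (_ \in _);
  by rewrite ?subrr ?subr0 ?sub0r ?normrN ?normr0 ?normr1 ?ler01.
Qed.

Lemma window_density_finite P N p : (forall k, P k -> (k < N)%N) ->
  window_density P p <= N%:R * (p.2 - p.1)%:R^-1.
Proof.
move=> PN; apply: ler_wpM2r; first by rewrite invr_ge0.
apply: (@le_trans _ _ (\sum_(0 <= i < N) 1%N)%:R); last first.
  by rewrite sum_nat_const_nat subn0 muln1.
apply: (@le_trans _ _ (\sum_(p.1 <= i < p.2 | (i < N)%N) 1%N)%:R).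
  rewrite natr_sum [leRHS]big_mkcond /=; apply: ler_sum => i _.
  rewrite indicE; case: ifPn => iN; first by case: (_ \in _).
  rewrite memNset// => /PN; apply/negP; apply: contra iN; exact: ltnW.
rewrite !sum1_count ler_nat count_predT size_iota subn0 -size_filter.
rewrite -[leqRHS](size_iota 0); apply: uniq_leq_size.
  by rewrite filter_uniq// iota_uniq.
by move=> i; rewrite mem_filter mem_iota => /andP[].
Qed.

End window_density.

Lemma ultra_fmap (T U : Type) (f : T -> U) (F : set_system T) :
  UltraFilter F -> UltraFilter (f @ F).
Proof.
move=> FU; split => [|G GF fFG]; first exact: fmap_proper_filter.
apply/seteqP; split => // S GS.
have [//|nS] := in_ultra_setVsetC (f @^-1` S) FU.
have /(filterI GS) : G (~` S) by exact: fFG.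
by rewrite setICr => /filter_not_empty.
Qed.

Section invariant_mean.
Context (K : realType).

(** Serves both shift invariance and vanishing on finite sets: each has an error of order 1 over the
    window length. *)
Lemma gap_to_infty_inv (F : set_system (nat * nat)) (c : K)
    (f : nat * nat -> K) : Filter F -> gap_to_infty `<=` F -> 0 <= c ->
  (forall p, `|f p| <= c * (p.2 - p.1)%:R^-1) -> f @ F --> (0 : K).
Proof.
move=> FF gF c0 fc; apply/cvgr0Pnorm_le => e e0.
pose k := (Num.truncn (c / e)).+1.
suff : F [set p | (k <= p.2 - p.1)%N].
  apply: filterS => p /= kp; apply: le_trans (fc p) _.
  have k0 : 0 < (p.2 - p.1)%:R :> K by rewrite ltr0n (leq_trans _ kp).
  rewrite ler_pdivrMr// mulrC -ler_pdivrMr//.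
  apply: (@le_trans _ _ k%:R); last by rewrite ler_nat.
  by rewrite ltW// truncnS_gt.
by apply: gF; exists k.
Qed.

Lemma exists_invariant_mean (A : set nat) : (0 < upper_banach_density K A)%E ->
  exists m : set nat -> K,
  [/\ (forall P, 0 <= m P), m setT = 1,
      (forall P Q, P `&` Q = set0 -> m (P `|` Q) = m P + m Q),
      (forall P, m [set k | P k.+1] = m P) &
      (forall P N, (forall k, P k -> (k < N)%N) -> m P = 0) /\ 0 < m A].
Proof.
move=> dA.
have [e e0 eA] : exists2 e : K, 0 < e & (e%:E < upper_banach_density K A)%E.
  case: (upper_banach_density K A) dA => [r|_|//].
    rewrite lte_fin => r0; exists (r / 2); first by lra.
    by rewrite lte_fin; lra.
  by exists 1; rewrite ?ltry.
(* The density of [A] is bounded below on these windows, so any limit along a filter containing them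
   is at least [e]. *)
pose B k := [set p : nat * nat |
  (k <= p.2 - p.1)%N /\ e <= window_density K A p].
have PF : ProperFilter (filter_from [set: nat] B).
  apply: filter_from_proper => [|k _].
    apply: filter_from_filter => [|i j _ _]; first by exists 0%N.
    exists (maxn i j) => // p [+ ep]; rewrite geq_max => /andP[ip jp].
    by split.
  (* The limsup is an infimum of such suprema, so arbitrarily long windows have density above
     [e]. *)
  have : (e%:E < ereal_sup [set (window_density K A p)%:E | p in
                 [set p | (k <= p.2 - p.1)%N]])%E.
    apply: lt_le_trans eA _; apply: ereal_inf_lbound => /=.
    exists [set p : nat * nat | (k <= p.2 - p.1)%N]; first by exists k.
    by congr ereal_sup; apply: eq_imagel => p _; rewrite window_densityE.
  move=> /ereal_sup_gt[_ [p kp <-]]; rewrite lte_fin => /ltW ep.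
  by exists p.
have [U [UU BU]] := ultraFilterLemma PF.
have gU : gap_to_infty `<=` U.
  move=> S [k _ kS]; apply: BU; exists k => // p [kp _]; exact: kS.
have cd P : cvg (window_density K P @ U).
  (* The image ultrafilter lives on the compact segment [0, 1], hence converges. *)
  have := @segment_compact K 0 1; rewrite compact_ultra.
  move=> /(_ (window_density K P @ U) (ultra_fmap _ UU)) [].
    apply: (@filterE _ U _ (window_density K P @^-1` _)) => p /=.
    by rewrite in_itv /= window_density_ge0 window_density_le1.
  by move=> l [_ lP]; apply/cvg_ex; exists l.
pose m P := lim (window_density K P @ U).
exists m; split.
- move=> P; apply: limr_ge => //; apply: nearW => p.
  exact: window_density_ge0.
- apply/cvg_lim => //; apply: cvg_near_cst.
  apply: gU; exists 1%N => // p /= kp.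
  exact: window_densityT.
- move=> P Q PQ; rewrite /m -limD//; congr (lim (_ @ U)); apply/funext => p.
  exact: window_densityU.
- move=> P; apply/eqP; rewrite -subr_eq0; apply/eqP.
  rewrite /m -limB//; apply/cvg_lim => //.
  apply: (@gap_to_infty_inv _ 1) => // p; rewrite mul1r.
  exact: window_density_shift.
split.
  move=> P N PN; apply/cvg_lim => //.
  apply: (@gap_to_infty_inv _ N%:R) => // p.
  by rewrite ger0_norm ?window_density_ge0//; exact: window_density_finite.
apply: lt_le_trans e0 _; apply: limr_ge => //.
by apply: BU; exists 0%N => // p [].
Qed.

End invariant_mean.

(** * Laws on bit streams *)

Definition ones (s : seq nat) : set (nat -> bool) :=
  [set y : nat -> bool | all y s].

(** This is the product sigma-algebra: a prescribed 0 is the complement of a prescribed 1. Cylinders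
    of ones alone are stable under intersection, so they determine a law. *)
Definition bitstream := g_sigma_algebraType (range ones).

(* Most recent letter first: the prefix of [y] of length [n], reversed. *)
Fixpoint history (y : nat -> bool) (n : nat) : seq bool :=
  if n is n'.+1 then y n' :: history y n' else [::].

Lemma nth_history y n i : (i < n)%N -> nth false (history y n) (n - i.+1) = y i.
Proof.
elim: n => // n IH; rewrite ltnS leq_eqVlt => /predU1P[->|lin].
  by rewrite subnn.
by rewrite subSS -(IH lin) subnS; case: (n - i)%N (subn_gt0 i n); rewrite lin.
Qed.

(** Words are reversed: the letter of time [i] sits at index [n - i.+1]. *)
Definition ones_word (n : nat) (s : seq nat) : pred (seq bool) :=
  fun w => all (fun i => nth false w (n - i.+1)) s.

Lemma ones_history s n y : all (gtn n) s ->
  ones s y <-> ones_word n s (history y n).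
Proof.
move=> /allP sn; rewrite /ones /=.
suff -> : all y s = ones_word n s (history y n) by [].
by apply: eq_in_all => i /sn/nth_history ->.
Qed.

Lemma measurable_ones s : measurable (ones s : set bitstream).
Proof.
by have : range ones (ones s); [exists s|exact: (@sub_sigma_algebra _ setT)].
Qed.

Lemma setI_closed_ones : setI_closed (range ones).
Proof.
move=> _ _ [s _ <-] [t _ <-]; exists (s ++ t) => //.
by apply/seteqP; split => y; rewrite /ones /= all_cat => /andP.
Qed.

Section unit_interval.
Context (K : realType).

Definition unit_lebesgue : set (measurableTypeR K) -> \bar K :=
  mrestr lebesgue_measure (measurable_itv `[(0:K), 1[).

HB.instance Definition _ := Measure.on unit_lebesgue.

Lemma unit_lebesgue_setT : unit_lebesgue setT = 1%E.
Proof.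
rewrite /unit_lebesgue /mrestr setTI lebesgue_measure_itv /= lte_fin ltr01.
by rewrite oppr0 adde0.
Qed.

HB.instance Definition _ :=
  Measure_isProbability.Build _ _ _ unit_lebesgue unit_lebesgue_setT.

End unit_interval.

(** * A law on bit streams from a finitely additive mean *)

Section finitely_additive.
Context (K : realType) (T : Type) (m : set T -> K) (A : nat -> set T).
Hypothesis m_ge0 : forall P, 0 <= m P.
Hypothesis mT : m setT = 1.
Hypothesis mU : forall P Q, P `&` Q = set0 -> m (P `|` Q) = m P + m Q.

(* Each word [w] gets the interval [left_end w, left_end w + mass w[, so that
   the two one-letter extensions of [w] split its interval; [digits] reads off
   the infinite word whose intervals all contain [x], and pushes Lebesgue
   measure on [0, 1[ forward to the law with cylinder probabilities [mass]. *)
Let code (k : T) : nat -> bool := fun i => `[< A i k >].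
Let mass (w : seq bool) := m [set k | history (code k) (size w) = w].

(** The extension by [false] takes the left piece of the interval, the one by [true] the right
    piece. *)
Fixpoint left_end (w : seq bool) : K :=
  if w is b :: w' then left_end w' + (if b then mass (false :: w') else 0)
  else 0.

Fixpoint word (x : K) (n : nat) : seq bool :=
  if n is n'.+1 then
    (left_end (word x n') + mass (false :: word x n') <= x) :: word x n'
  else [::].

Definition digits (x : measurableTypeR K) : bitstream :=
  fun n => left_end (word x n) + mass (false :: word x n) <= x.

Lemma history_digits x n : history (digits x) n = word x n.
Proof. by elim: n => //= n ->. Qed.

(** Splits according to the next letter. The extra condition [P] lets the same split drive the
    induction on longer words. *)
Lemma mass_split w P : let n := size w in
  m [set k | P k /\ history (code k) n = w] =
  m [set k | P k /\ history (code k) n.+1 = true :: w] +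
  m [set k | P k /\ history (code k) n.+1 = false :: w].
Proof.
rewrite /= -mU.
  congr m; apply/seteqP; split => k /=.
    by move=> [Pk hw]; rewrite hw; case: (code k _); [left|right].
  by move=> [[Pk [_ ->]]|[Pk [_ ->]]].
by apply/seteqP; split => // k [] [_ +] [_ +] => /= -[->] _ [].
Qed.

Lemma massE w : mass w = mass (true :: w) + mass (false :: w).
Proof.
have := mass_split w (fun=> True).
rewrite /mass /=; set a := m _ => h.
rewrite (_ : m _ = a); last by congr m; apply/seteqP; split => k /=; tauto.
by rewrite h; congr (m _ + m _); apply/seteqP; split => k /=; tauto.
Qed.

(** Induction on [w]: the threshold that decides the next letter is the common endpoint of the two
    subintervals, which tile that of [w] by [massE]. *)
Lemma word_itv w x : 0 <= x < 1 ->
  word x (size w) = w <-> left_end w <= x < left_end w + mass w.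
Proof.
move=> x01; elim: w => [|b w IH] /=.
  rewrite add0r (_ : mass [::] = 1)// -mT /mass; congr m.
  by apply/seteqP; split.
have := massE w.
have := m_ge0 [set k | history (code k) (size w).+1 = true :: w].
have := m_ge0 [set k | history (code k) (size w).+1 = false :: w].
rewrite -/(mass (true :: w)) -/(mass (false :: w)) => M0 M1 Mw.
split.
  move=> [+ hw]; rewrite hw; move/IH: hw => /andP[lx xl].
  by case: b => [->|/negbT]; rewrite ?addr0 -?ltNge; lra.
move=> bw; have hw : word x (size w) = w by apply/IH; case: b bw => bw; lra.
rewrite hw; congr (_ :: _); case: b bw => bw; first by lra.
by apply/negbTE; rewrite -ltNge; lra.
Qed.

Lemma left_end_ge0 w : 0 <= left_end w.
Proof.
elim: w => //= b w IH; apply: addr_ge0 => //; case: b => //; exact: m_ge0.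
Qed.

Lemma left_endD_mass_le1 w : left_end w + mass w <= 1.
Proof.
elim: w => [|b w IH].
  rewrite add0r (_ : mass [::] = 1)// -mT; congr m.
  by apply/seteqP; split.
apply: le_trans IH; rewrite /= (massE w).
have := m_ge0 [set k | history (code k) (size w).+1 = true :: w].
have := m_ge0 [set k | history (code k) (size w).+1 = false :: w].
rewrite -/(mass (true :: w)) -/(mass (false :: w)).
by case: b; lra.
Qed.

(** Once the earlier letters are fixed, the next one compares [x] with a constant, which cuts out a
    half-line. *)
Lemma measurable_word_eq n w :
  measurable [set x : measurableTypeR K | word x n = w].
Proof.
elim: n w => [|n IH] [|b w] /=.
- rewrite (_ : [set _ | _] = setT); first exact: measurableT.
  by apply/seteqP; split.
- rewrite (_ : [set _ | _] = set0); first exact: measurable0.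
  by apply/seteqP; split.
- rewrite (_ : [set _ | _] = set0); first exact: measurable0.
  by apply/seteqP; split.
pose c := left_end w + mass (false :: w).
rewrite (_ : [set _ | _] = [set x | word x n = w] `&`
   [set` if b then `[c, +oo[ else `]-oo, c[]).
  by apply: measurableI => //; case: b; exact: measurable_itv.
apply/seteqP; split => x /=.
  by move=> [+ hw]; rewrite hw => <-; split => //; case: (leP c x) => cx;
    rewrite in_itv /= ?andbT.
move=> [-> cx]; congr (_ :: _); case: b cx; rewrite in_itv /= ?andbT //.
by rewrite -/c ltNge => /negbTE.
Qed.

Lemma measurable_word n (P : pred (seq bool)) :
  measurable [set x : measurableTypeR K | P (word x n)].
Proof.
rewrite (_ : [set _ | _] =
    \bigcup_w ([set x | word x n = w] `&` [set _ | P w])).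
  apply: countable_bigcupT_measurable => // w.
  apply: measurableI; first exact: measurable_word_eq.
  case: (P w).
    rewrite (_ : [set _ | _] = setT); first exact: measurableT.
    by apply/seteqP; split.
  rewrite (_ : [set _ | _] = set0); first exact: measurable0.
  by apply/seteqP; split.
by apply/seteqP; split => [x Px|x [w _] [<-]]//; exists (word x n).
Qed.

Lemma unit_lebesgue_word w :
  unit_lebesgue [set x : measurableTypeR K | word x (size w) = w] = (mass w)%:E.
Proof.
rewrite /unit_lebesgue /mrestr.
have l0 := left_end_ge0 w; have l1 := left_endD_mass_le1 w.
rewrite (_ : _ `&` _ = [set` `[left_end w, left_end w + mass w[]).
  rewrite lebesgue_measure_itv /= lte_fin ltrDl.
  have : 0 <= mass w by exact: m_ge0.
  rewrite le_eqVlt => /predU1P[<-|->]; first by rewrite ltxx.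
  by rewrite -EFinB addrC addKr.
apply/seteqP; split => x /=; rewrite !in_itv /=.
  by move=> [+ x01] => /(word_itv w x01).
by move=> xw; have x01 : 0 <= x < 1 by [lra]; split => //; apply/word_itv.
Qed.

(** Induction on the number [j] of letters still to be read after [w]: both sides split over the
    next letter, and for [j = 0] the claim is an interval length. *)
Lemma unit_lebesgue_word_pred (P : pred (seq bool)) n j w :
  n = (j + size w)%N ->
  unit_lebesgue
    [set x : measurableTypeR K | P (word x n) /\ word x (size w) = w] =
  (m [set k | P (history (code k) n) /\ history (code k) (size w) = w])%:E.
Proof.
elim: j w => [|j IH] w nE.
  rewrite {}nE add0n; have [Pw|Pw] := boolP (P w).
    rewrite (_ : [set _ | _] = [set x | word x (size w) = w]).
      rewrite unit_lebesgue_word; congr (m _)%:E.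
      by apply/seteqP; split => x /= => [h|[]//]; rewrite h.
    by apply/seteqP; split => x /= => [[]//|h]; rewrite h.
  rewrite (_ : [set _ | _] = set0); last first.
    by apply/seteqP; split => x //= [/[swap] ->]; apply/negP.
  rewrite (_ : [set _ | _] = set0) ?measure0; last first.
    by apply/seteqP; split => x //= [/[swap] ->]; apply/negP.
  (* Additivity on two empty sets gives [m set0 = 0]. *)
  have := mU (setI0 set0); rewrite setU0 => h; congr EFin.
  by move: h; lra.
have IHb b := IH (b :: w) (etrans nE (addSnnS _ _)).
rewrite mass_split EFinD -(IHb true) -(IHb false) -measureU.
- congr unit_lebesgue; apply/seteqP; split => x /=.
    by move=> [Px ->]; case: (_ <= x); [left|right].
  by move=> [[Px [_ ->]]|[Px [_ ->]]].
- apply: measurableI; first exact: measurable_word.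
  exact: (measurable_word_eq (size w).+1).
- apply: measurableI; first exact: measurable_word.
  exact: (measurable_word_eq (size w).+1).
- by apply/seteqP; split => // x [] [_ +] [_ +] => /= -[->] _ [].
Qed.

Lemma ones_digits s n : all (gtn n) s ->
  digits @^-1` ones s = [set x | ones_word n s (word x n)].
Proof.
move=> sn; apply/seteqP; split => x /=; rewrite -history_digits.
  by move/(ones_history (digits x) sn).
by move=> h; apply/(ones_history (digits x) sn).
Qed.

Lemma exists_strict_bound (s : seq nat) : exists n, all (gtn n) s.
Proof.
exists (\max_(i <- s) i).+1; apply/allP => i si /=.
by rewrite ltnS (big_rem i) //= leq_maxl.
Qed.

Lemma measurable_digits : measurable_fun setT digits.
Proof.
apply: (@measurability _ _ (measurableTypeR K) bitstream setT digits
  (range ones)) => // _ [_ [s _ <-] <-].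
have [n sn] := exists_strict_bound s.
rewrite setTI (ones_digits sn); exact: measurable_word.
Qed.

HB.instance Definition _ := isMeasurableFun.Build _ _ _ _ _ measurable_digits.

(** Finite additivity of [m] suffices: each cylinder depends on finitely many letters, and countable
    additivity comes from Lebesgue measure. *)
Lemma exists_bitstream_law :
  exists mu : probability bitstream K,
    forall s, mu (ones s) = (m [set k | forall i : nat, i \in s -> A i k])%:E.
Proof.
exists (distribution (@unit_lebesgue K) digits) => s.
have [n sn] := exists_strict_bound s.
rewrite -[LHS]/(unit_lebesgue (digits @^-1` ones s)) (ones_digits sn).
transitivity (unit_lebesgue
    [set x : measurableTypeR K |
      ones_word n s (word x n) /\ word x (size (@nil bool)) = [::]]).
  by congr unit_lebesgue; apply/seteqP; split => x //= -[].
rewrite (@unit_lebesgue_word_pred (ones_word n s) n n) ?addn0//.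
congr (m _)%:E.
apply/seteqP; split => k /=.
  by move=> [/(ones_history (code k) sn)/allP h _] i /h /asboolP.
move=> h; split => //; apply/(ones_history (code k) sn)/allP => i /h ?.
exact/asboolP.
Qed.

End finitely_additive.

(** * Recurrence and the sumset *)

Lemma bergelson_intersectivity (K : realType) d (X : measurableType d)
    (mu : probability X K) (E : nat -> set X) (S : set nat) :
  (forall n, measurable (E n)) ->
  (0 < limf_esup (fun n => mu (E n)) (within S \oo))%E ->
  exists B : set nat, [/\ B `<=` S, (forall N, exists2 n, (N <= n)%N & B n) &
    forall s : seq nat, (forall i, i \in s -> B i) ->
      (0 < mu (\bigcap_(i in [set` s]) E i))%E].
Proof.
move=> mE L0; set L := limf_esup _ _ in L0.
(* Emptying the sets with index outside [S] makes the ordinary limsup of sets one along [S]. *)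
pose G n := if n \in S then E n else set0.
have mG n : measurable (G n) by rewrite /G; case: ifP.
have LG N : (L <= mu (\bigcup_(k >= N) G k))%E.
  apply: le_trans (_ : ereal_sup
      ((fun n => mu (E n)) @` [set n | S n /\ (N <= n)%N]) <= _)%E.
    apply: ereal_inf_lbound; exists [set n | S n /\ (N <= n)%N] => //.
    by exists N => // n /= Nn Sn.
  apply: ge_ereal_sup => _ [n [Sn Nn] <-].
  apply: le_measure; rewrite ?inE//.
    by apply: bigcup_measurable => k _; exact: mG.
  by move=> x Ex; exists n => //; rewrite /G mem_set.
(* The tail unions decrease to the limsup set and have finite measure, so their lower bound [L]
   survives. *)
have Lsup : (L <= mu (lim_sup_set G))%E.
  apply: cvge_ge (lim_sup_set_cvg mu G mG _); first exact: nearW.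
  apply: le_lt_trans (probability_le1 _ _) (ltry 1).
  exact: bigcup_measurable.
pose J (s : seq nat) : set X := \bigcap_(i in [set` s]) E i.
have mJ s : measurable (J s) by apply: bigcap_measurableType => i _; exact: mE.
(* Finite sequences are countable, so the union [Z] of all null finite intersections is null. *)
pose W s := if mu (J s) == 0%E then J s else set0.
pose Z := \bigcup_(k in [set: nat]) oapp W set0 (choice.unpickle k).
have Z0 : mu.-negligible Z.
  apply: negligible_bigcup => k.
  case: (choice.unpickle k) => [s|] /=; last exact: negligible_set0.
  rewrite /W; case: ifP => [/eqP s0|_]; last exact: negligible_set0.
  by apply/negligibleP => //; exact: mJ.
have [x xG xZ] : exists2 x, lim_sup_set G x & ~ Z x.
  apply: contrapT => /forall2NP H.
  have : mu (lim_sup_set G) = 0%E.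
    apply: measure_negligible.
      apply: bigcap_measurable => // k _.
      by apply: bigcup_measurable => j _; exact: mG.
    by apply: negligibleS Z0 => x xG; have [//|/contrapT] := H x.
  by move=> h; move: (lt_le_trans L0 Lsup); rewrite h ltxx.
exists [set n | S n /\ E n x]; split => [n []//|N|s sB].
  have [n Nn] := xG N I; rewrite /G; case: ifPn => // /set_mem Sn Ex.
  by exists n.
rewrite lt0e measure_ge0 andbT; apply/eqP => s0; apply: xZ.
exists (choice.pickle s) => //.
by rewrite choice.pickleK /= /W s0 eqxx => i /= /sB[].
Qed.

Lemma infinite_unbounded (S : set nat) :
  (forall N, exists2 n, (N <= n)%N & S n) -> infinite_set S.
Proof.
move=> SN /finite_seqP[s Ss]; have [N /allP sN] := exists_strict_bound s.
have [n Nn] := SN N; rewrite Ss /= => /sN /=.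
by rewrite ltnNge Nn.
Qed.

Lemma interleaved_sumset (A B0 : set nat) :
  (forall N, exists2 n, (N <= n)%N & B0 n) ->
  (forall (s : seq nat) N, (forall i, i \in s -> B0 i) ->
    exists2 k, (N <= k)%N & A k /\ forall i, i \in s -> A (k + i)%N) ->
  exists B C : set nat,
    [/\ infinite_set B, infinite_set C, B `<=` B0, C `<=` A &
        forall b c : nat, B b -> C c -> (b < c)%N -> A (b + c)%N].
Proof.
move=> B0N AB.
have /choice[h hP] : forall N, exists n, (N <= n)%N /\ B0 n.
  by move=> N; have [n] := B0N N; exists n.
have /choice[g gP] : forall N, exists k, [/\ (N < k)%N, A k &
    forall i, (i <= N)%N -> B0 i -> A (k + i)%N].
  move=> N.
  have [|k Nk [Ak Ai]] := AB [seq i <- iota 0 N.+1 | i \in B0] N.+1.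
    by move=> i; rewrite mem_filter => /andP[/set_mem].
  exists k; split => // i iN Bi; apply: Ai.
  by rewrite mem_filter mem_set// mem_iota ltnS.
(* The elements of [C] are [g (b n)]: each is chosen to suit every element of [B0] up to [b n], and
   [b n.+1] is then taken at or beyond it. *)
pose b n := iter n (h \o g) (h 0%N).
have bB n : B0 (b n).
  by case: n => [|n]; [exact: (hP 0%N).2|exact: (hP (g (b n))).2].
have bS n : (g (b n) <= b n.+1)%N by exact: (hP (g (b n))).1.
have gb n : (b n < g (b n))%N by have [] := gP (b n).
have b_lt : {homo b : i j / (i < j)%N}.
  by apply: homo_ltn => [? ? ?|n]; [exact: ltn_trans|exact: leq_trans (bS n)].
have b_le : {homo b : i j / (i <= j)%N} by exact: ltnW_homo.
have nb n : (n <= b n)%N.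
  by elim: n => // n IH; apply: leq_ltn_trans IH _; exact: b_lt.
exists (range b), (range (g \o b)); split.
- by apply: infinite_unbounded => N; exists (b N).
- apply: infinite_unbounded => N; exists (g (b N)) => //.
  by rewrite (leq_trans (nb N))// ltnW.
- by move=> _ [n _ <-].
- by move=> _ [n _ <-]; have [] := gP (b n).
move=> _ _ [i _ <-] [j _ <-] /= ij.
have [_ _] := gP (b j); rewrite addnC; apply => //.
(* If [j < i], then [g (b j) <= b j.+1 <= b i], against [b i < g (b j)]. *)
apply: (b_le); rewrite leqNgt; apply: contraL ij => ji.
by rewrite -leqNgt (leq_trans (bS j))// b_le.
Qed.

(** * The shift on bit streams and the conclusion *)

Definition shift (y : bitstream) : bitstream := fun n => y n.+1.

Lemma iter_shift n y i : iter n shift y i = y (i + n)%N.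
Proof. by elim: n i => [|n IH] i /=; rewrite ?addn0// /shift IH addSnnS. Qed.

Lemma preimage_shift_ones s : shift @^-1` ones s = ones (map S s).
Proof. by apply/seteqP; split => y /=; rewrite /ones /= all_map. Qed.

Lemma measurable_shift : measurable_fun setT shift.
Proof.
apply: (@measurability _ _ bitstream bitstream setT shift (range ones)) => //.
move=> _ [_ [s _ <-] <-]; rewrite setTI preimage_shift_ones.
exact: measurable_ones.
Qed.

HB.instance Definition _ := isMeasurableFun.Build _ _ _ _ _ measurable_shift.

(** The law and its image under the shift agree on a generating family stable under intersection,
    hence everywhere. *)
Lemma measure_preserving_shift (K : realType)
    (mu : probability bitstream K) :
  (forall s, mu (ones (map S s)) = mu (ones s)) -> measure_preserving mu shift.
Proof.
move=> muS; split; first exact: measurable_shift.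
move=> E mE; rewrite -[LHS]/(distribution mu shift E).
apply: (@measure_unique _ K bitstream (range ones) (fun=> setT) _ _ _ _
  (distribution mu shift) mu) => //.
- exact: setI_closed_ones.
- by move=> _; exists [::] => //; apply/seteqP; split.
- by apply/seteqP; split => // x _; exists 0%N.
- by move=> _ [s _ <-]; rewrite [RHS](esym (muS s)) -preimage_shift_ones.
- move=> _; apply: le_lt_trans (ltry 1).
  exact: (@probability_le1 _ _ _ (distribution mu shift) setT measurableT).
Qed.

Theorem theorem3p32 (K : realType) (R : set nat)
    (hR : strong_recurrence K R) (A : set nat)
    (hA : (0 < upper_banach_density K A)%E) :
  exists B C : set nat,
    [/\ infinite_set B, infinite_set C, B `<=` R, C `<=` A &
        forall b c : nat, B b -> C c -> (b < c)%N -> A (b + c)%N].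
Proof.
have [m [m_ge0 mT mU mS [m_fin mA]]] := exists_invariant_mean hA.
have [mu muE] :=
  exists_bitstream_law (fun i => [set k | A (k + i)%N]) m_ge0 mT mU.
have mu_shift : measure_preserving mu shift.
  apply: measure_preserving_shift => s; rewrite !muE; congr _%:E.
  (* Moving all positions by one amounts to translating [k] by one, which [m] does not see. *)
  rewrite -[RHS]mS; congr m; apply/seteqP; split => k /= H i.
    by move=> si; rewrite addSnnS; apply: H; exact: map_f.
  by move=> /mapP[j sj ->]; rewrite -addSnnS; exact: H.
have ones0 n : ones [:: 0%N] `&` iter n shift @^-1` ones [:: 0%N] =
    ones [:: 0%N; n].
  apply/seteqP; split => y; rewrite /ones /= iter_shift add0n !andbT.
    by move=> [-> ->].
  by move=> /andP[].
have mu0 : (0 < mu (ones [:: 0%N]))%E.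
  rewrite muE lte_fin (_ : [set _ | _] = A)//; apply/seteqP; split => k /=.
    by move=> h; have := h 0%N (mem_head _ _); rewrite addn0.
  by move=> Ak i; rewrite inE => /eqP ->; rewrite addn0.
have := hR _ _ _ _ mu_shift _ (measurable_ones [:: 0%N]) mu0.
under eq_fun do rewrite ones0.
move=> /(@bergelson_intersectivity _ _ _ mu (fun n => ones [:: 0%N; n])).
move=> /(_ (fun n => measurable_ones _)) [B0 [B0R B0_unbounded B0_inter]].
suff [B [C [iB iC BB0 CA BC]]] : exists B C : set nat,
    [/\ infinite_set B, infinite_set C, B `<=` B0, C `<=` A &
        forall b c : nat, B b -> C c -> (b < c)%N -> A (b + c)%N].
  by exists B, C; split => //; exact: subset_trans B0R.
apply: interleaved_sumset => // s N sB0.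
(* Adding [n0] keeps the list nonempty, so the intersection forces a 1 at position 0 even when [s]
   is empty. *)
have [n0 _ Bn0] := B0_unbounded 0%N.
have sB0' i : i \in n0 :: s -> B0 i.
  by rewrite inE => /predU1P[->|/sB0].
have := B0_inter _ sB0'.
rewrite (_ : \bigcap_(i in _) _ = ones (0%N :: n0 :: s)); last first.
  apply/seteqP; split => y.
    move=> H; apply/allP => i; rewrite inE => /predU1P[->|si].
      by have := H n0 (mem_head _ _); rewrite /ones /= => /andP[].
    by have := H i si; rewrite /ones /= andbT => /andP[].
  move=> /allP H i si; rewrite /ones /= andbT; apply/andP; split.
    by apply: H; rewrite mem_head.
  by apply: H; rewrite inE (si : i \in n0 :: s) orbT.
rewrite muE lte_fin => mQ; apply: contrapT => noK.
(* Without a suitable [k >= N] this set lies below [N], where [m] vanishes. *)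
suff m0 : m [set k | forall i : nat, i \in [:: 0%N, n0 & s] -> A (k + i)%N] = 0.
  by rewrite m0 ltxx in mQ.
apply: (m_fin _ N) => k Hk; rewrite ltnNge; apply/negP => Nk; apply: noK.
exists k => //; split; first by have := Hk 0%N (mem_head _ _); rewrite addn0.
by move=> i si; apply: Hk; rewrite !inE si !orbT.
Qed.
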